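(* Let $\alpha\in(0,1)$ and $a\in\mathbb R$. (i) On $\mathcal M_{a,0}\cap\mathcal M_{\mathrm{inc,cont}}$ the functional $F\mapsto\Gamma_\alpha(F)(a)\in[a,\infty]$ is identifiable with a strict identification function $V\colon[a,\infty]\times\mathbb R\to\mathbb R$, $V(x,y)=\mathbf 1\{y\in[a,x]\}-\alpha$. (ii) On $\mathcal M_{a,\alpha,\mathrm{inc}}$ the functional $F\mapsto\Gamma_\alpha(F)(a)\in[a,\infty]$ is elicitable. An $\mathcal M_{a,0}$-consistent scoring function is given by $S\colon[a,\infty]\times\mathbb R\to\mathbb R$, $$S(x,y)=-\int_{[x,\infty)}V(z,y)\,d\mu(z)=\alpha\mu([x,\infty))-\mu\big([x,\infty)\cap[y,\infty)\big)\mathbf 1\{y\ge a\},$$ where $\mu$ is a non-negative finite measure on $\mathbb R$. If moreover $\mu$ is positive, $S$ is also strictly $\mathcal M_{a,\alpha,\mathrm{inc}}$-consistent.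
   Context: $\mathcal M_0$ is the class of Borel probability distributions on $\mathbb R$ (identified with distribution functions); $\bar{\mathbb R}=\mathbb R\cup\{\pm\infty\}$; $F(a-)=F((-\infty,a))$; $F([a,b]):=F([a,b]\cap\mathbb R)$. $q_\beta(F)=\{t\in\bar{\mathbb R}:F((-\infty,t))\le\beta\le F((-\infty,t])\}$. $\mathcal M_{\mathrm{inc,cont}}$: continuous distribution functions that are strictly increasing on $\mathbb R$. $\mathcal M_{a,0}=\{F\in\mathcal M_0:F(a-)\le1-\alpha\}$. $\mathcal M_{a,\alpha,\mathrm{inc}}$: all $F\in\mathcal M_{a,0}$ such that $q_{\alpha+F(a-)}(F)$ is a singleton. For $F\in\mathcal M_{a,0}$, $\Gamma_\alpha(F)(a)=\inf\{b\ge a:F([a,b])\ge\alpha\}=\inf q_{\alpha+F(a-)}(F)$. A measure is positive if every nonempty open set has positive measure. $\bar V(x,F)=\int V(x,y)\,dF(y)$, $\bar S(x,F)=\int S(x,y)\,dF(y)$. $V$ is a strict $\mathcal M'$-identification function for $T\colon\mathcal M'\to\mathsf A$ if for all $x\in\mathsf A,F\in\mathcal M'$: $\bar V(x,F)=0$ iff $x=T(F)$. $S$ is $\mathcal M'$-consistent for $T$ if $\bar S(T(F),F)\le\bar S(x,F)$ for all $x\in\mathsf A,F\in\mathcal M'$, strictly so if equality implies $x=T(F)$. $T$ is elicitable (identifiable) on $\mathcal M'$ if a strictly $\mathcal M'$-consistent scoring function with finite expectations (a strict $\mathcal M'$-identification function) exists. *)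

(* Defs.v *)
From HB Require Import structures.
From mathcomp Require Import all_boot all_order all_algebra.
From mathcomp Require Import all_classical all_reals all_analysis.

Set Implicit Arguments.
Unset Strict Implicit.
Unset Printing Implicit Defensive.

Import Order.TTheory GRing.Theory Num.Theory.
Import numFieldNormedType.Exports.

Local Open Scope classical_set_scope.
Local Open Scope ring_scope.
Local Open Scope ereal_scope.

(* [M0 R] is the class of Borel probability distributions on the line. *)
Notation M0 R := (probability (measurableTypeR R) R).

(* The trace on R of an interval with extended real end points, so that
   F([a, b]) is F([a, b] `&` R) even when b = +oo. *)
Definition itvR (R : realType) (i : interval (\bar R)) : set R :=
  EFin @^-1` [set` i].

Section identification_and_scoring.
Context {R : realType} {X : Type}.
Implicit Types (M : set (M0 R)) (A : set X) (T : M0 R -> X) (g : X -> R -> R).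

(* Throughout, [M] is the class of distributions and [A] the action domain;
   functions on [A] are represented by functions on the ambient type [X] and
   only their values on [A] are used. *)

Definition expectation_fun g (x : X) (F : M0 R) : \bar R :=
  \int[F]_y (g x y)%:E.

(* Includes the measurability of each g x. *)
Definition finite_expectations M A g : Prop :=
  forall x F, A x -> M F -> F.-integrable [set: R] (EFin \o g x).

(* Integrability is part of the definition because [\int] is a total operator:
   the equation below is meaningful only for integrable V x. *)
Definition strict_identification_function M A T (V : X -> R -> R) : Prop :=
  finite_expectations M A V /\
  forall x F, A x -> M F -> (expectation_fun V x F = 0 <-> x = T F).

Definition consistent M A T (S : X -> R -> R) : Prop :=
  forall x F, A x -> M F -> expectation_fun S (T F) F <= expectation_fun S x F.

Definition strictly_consistent M A T (S : X -> R -> R) : Prop :=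
  consistent M A T S /\
  forall x F, A x -> M F ->
    expectation_fun S (T F) F = expectation_fun S x F -> x = T F.

Definition identifiable M A T : Prop :=
  exists V, strict_identification_function M A T V.

Definition elicitable M A T : Prop :=
  exists S, finite_expectations M A S /\ strictly_consistent M A T S.

End identification_and_scoring.

Section systemic_quantile.
Context {R : realType}.
Implicit Types (F : M0 R) (alpha a : R).

Definition distr_fun F (t : R) : R := fine (F `]-oo, t]%classic).

Definition M_inc_cont : set (M0 R) :=
  [set F : M0 R | continuous (distr_fun F) /\
           {homo distr_fun F : s t / (s < t)%R}].

Definition quantile_set (beta : \bar R) F : set (\bar R) :=
  [set t | F (itvR `]-oo, t[) <= beta <= F (itvR `]-oo, t])].

Definition M_a0 alpha a : set (M0 R) :=
  [set F : M0 R | F `]-oo, a[%classic <= (1 - alpha)%:E].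

Definition M_a_alpha_inc alpha a : set (M0 R) :=
  [set F : M0 R | M_a0 alpha a F /\
           exists t, quantile_set (alpha%:E + F `]-oo, a[%classic) F = [set t]].

Definition Gamma alpha a F : \bar R :=
  ereal_inf [set b | a%:E <= b /\ alpha%:E <= F (itvR `[a%:E, b])].

Definition actions a : set (\bar R) := [set` `[a%:E, +oo]].

Definition Vfun alpha a (x : \bar R) (y : R) : R :=
  (\1_(itvR `[a%:E, x]) y - alpha)%R.

Definition Sfun alpha a (mu : {finite_measure set (measurableTypeR R) -> \bar R})
    (x : \bar R) (y : R) : R :=
  (- \int[mu]_(z in itvR `[x, +oo[) Vfun alpha a z%:E y)%R.

Definition positive_measure (mu : set (measurableTypeR R) -> \bar R) : Prop :=
  forall U : set R, open U -> U !=set0 -> 0 < mu U.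

End systemic_quantile.

(* Main.v *)
(* (i) The map x |-> F([a, x]) is strictly increasing and continuous, and by the
   intermediate value theorem it takes the value alpha (at x = +oo if
   F(a-) = 1 - alpha); any such point is the infimum defining Gamma.
   (ii) By Fubini, E S(x, Y) is minus the mu-integral over [x, oo[ of the excess
   F([a, z]) - alpha, which is negative for z < Gamma and nonnegative from Gamma
   on, so x = Gamma minimises it. If the quantile is unique, the excess vanishes
   nowhere beyond Gamma, and a positive mu charges the interval between x and
   Gamma. The normal distribution provides a positive finite measure. *)
From HB Require Import structures.
Require Import Defs.
From mathcomp Require Import all_boot all_order all_algebra.
From mathcomp Require Import all_classical all_reals all_analysis.
From mathcomp Require Import measurable_realfun.

Set Implicit Arguments.
Unset Strict Implicit.
Unset Printing Implicit Defensive.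

Import Order.TTheory GRing.Theory Num.Theory.
Import numFieldNormedType.Exports.

Local Open Scope classical_set_scope.
Local Open Scope ring_scope.

(** * Traces of intervals, bounded integrands and vanishing integrals *)

Lemma itvR_NyEFin (R : realType) (t : bool) (y : R) :
  itvR (Interval -oo%O (BSide t y%:E)) = [set` Interval -oo%O (BSide t y)].
Proof.
by apply/seteqP; split => z; rewrite /itvR /= !in_itv /=;
  case: t; rewrite /= ?lee_fin ?lte_fin.
Qed.

Lemma measurable_itvR (R : realType) (i : interval (\bar R)) :
  measurable (itvR i : set (measurableTypeR R)).
Proof.
rewrite -[itvR i]setTI.
exact: (@EFin_measurable R [set: R] measurableT _ (emeasurable_itv i)).
Qed.

Lemma finite_measure_bounded_integrable (R : realType) d
    (T : measurableType d)
    (nu : {finite_measure set T -> \bar R}) (D : set T) (f : T -> R) (M : R) :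
  measurable D -> measurable_fun D f -> (forall t, D t -> `|f t| <= M) ->
  nu.-integrable D (EFin \o f).
Proof.
move=> mD mf fM; apply: measurable_bounded_integrable => //.
- by rewrite -ge0_fin_numE// fin_num_measure.
- exists M; split; first exact: num_real.
  by move=> N MN t Dt; rewrite /= (le_trans (fM t Dt))// ltW.
Qed.

Lemma product_measure_bounded_integrable (R : realType) d1 d2
    (T1 : measurableType d1) (T2 : measurableType d2)
    (m1 : {finite_measure set T1 -> \bar R})
    (m2 : {finite_measure set T2 -> \bar R}) (f : T1 * T2 -> R) (M : R) :
  measurable_fun setT f -> (forall t, `|f t| <= M) ->
  (m1 \x m2)%E.-integrable setT (EFin \o f).
Proof.
move=> mf fM.
have m12_fin : ((m1 \x m2)%E [set: T1 * T2] < +oo)%E.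
  rewrite -setXTT product_measure1E// -ge0_fin_numE ?mule_ge0//.
  by rewrite fin_numM// fin_num_measure.
apply: measurable_bounded_integrable => //.
exists M; split; first exact: num_real.
by move=> N MN t _; rewrite /= (le_trans (fM t))// ltW.
Qed.

(** A nonnegative function with zero integral vanishes almost everywhere, so [E], on which it is
    positive, lies in a null set. *)
Lemma ge0_integral_eq0 d (T : measurableType d) (R : realType)
    (nu : {measure set T -> \bar R}) (D E : set T) (f : T -> R) :
  measurable D -> measurable E -> E `<=` D -> measurable_fun D f ->
  (forall t, D t -> 0 <= f t) -> (forall t, E t -> 0 < f t) ->
  (\int[nu]_(t in D) (f t)%:E = 0)%E -> nu E = 0%E.
Proof.
move=> mD mE ED mf f0 fE If0.
have mEf : measurable_fun D (EFin \o f) by exact/measurable_EFinP.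
have /(ae_eq_integral_abs nu mD mEf).1 : (\int[nu]_(t in D) `|(EFin \o f) t| = 0)%E.
  rewrite -[RHS]If0; apply: eq_integral => t; rewrite inE => Dt.
  by rewrite /= ger0_norm ?f0.
move=> ae0; apply/negligibleP => //; apply: negligibleS ae0 => t Et /= ft.
have := ft (ED _ Et) => -[ft0].
by have := fE _ Et; rewrite ft0 ltxx.
Qed.

Section systemic_quantile_theory.
Local Open Scope ereal_scope.
Context {R : realType}.
Implicit Types (F : M0 R) (alpha a : R) (x : \bar R).

(** * The mass of [a, x] and the expectation of [Vfun] *)

Lemma itvR_le_measure F (i j : interval (\bar R)) :
  (i <= j)%O -> F (itvR i) <= F (itvR j).
Proof.
move=> ij; apply: le_measure; rewrite ?inE; try exact: measurable_itvR.
by move=> y; apply: (subitvP ij).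
Qed.

(** Link between F([a, x]) and the distribution function: the finite term F(a-) can be added and
    cancelled, which carries continuity and monotonicity over to F([a, x]). *)
Lemma itvR_split F a x : a%:E <= x ->
  F (itvR `]-oo, x]) = F `]-oo, a[%classic + F (itvR `[a%:E, x]).
Proof.
move=> ax; rewrite -itvR_NyEFin -measureU; try exact: measurable_itvR.
- congr (F _); apply/seteqP; split => y; rewrite /itvR /setU /= !in_itv /=.
    by move=> yx; have [ya|ay] := ltP y%:E a%:E; [left|right; rewrite yx].
  by case=> [ya|/andP[]//]; exact: le_trans (ltW ya) ax.
- rewrite -subset0 /itvR /setI => y /=; rewrite !in_itv /= => -[ya /andP[ay _]].
  by rewrite leNgt ya in ay.
Qed.

Lemma probability_itvRy F a :
  F (itvR `[a%:E, +oo]) = 1 - F `]-oo, a[%classic.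
Proof.
have /esym := itvR_split F (leey a%:E).
have -> : itvR `]-oo, +oo] = [set: R].
  by apply/seteqP; split => y // _; rewrite /itvR /= in_itv /= leey.
by rewrite probability_setT => <-; rewrite addeAC subee ?add0e// fin_num_measure.
Qed.

Lemma measurable_Vfun alpha a x : measurable_fun [set: R] (Vfun alpha a x).
Proof.
by apply: measurable_funB => //; apply: measurable_indic; exact: measurable_itvR.
Qed.

Lemma Vfun_bounded alpha a x y : (`|Vfun alpha a x y| <= 1 + `|alpha|)%R.
Proof.
rewrite /Vfun (le_trans (ler_normB _ _))// lerD2r indicE.
by case: (_ \in _); rewrite ?normr0 ?normr1.
Qed.

Lemma integrable_Vfun F alpha a x :
  F.-integrable [set: R] (EFin \o Vfun alpha a x).
Proof.
apply: (@finite_measure_bounded_integrable _ _ _ F setT _ (1 + `|alpha|)%R) => //.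
  exact: measurable_Vfun.
by move=> y _; exact: Vfun_bounded.
Qed.

Lemma expectation_Vfun F alpha a x :
  expectation_fun (Vfun alpha a) x F = F (itvR `[a%:E, x]) - alpha%:E.
Proof.
rewrite /expectation_fun /Vfun.
under eq_integral do rewrite EFinB.
rewrite integralB_EFin//=.
- rewrite integral_indic//; last exact: measurable_itvR.
  rewrite setIT integral_cst//.
  by rewrite [X in _ * X](@probability_setT _ _ _ F) mule1.
- by apply: integrable_indic => //; exact: measurable_itvR.
- exact: finite_measure_integrable_cst.
Qed.

(** * [Gamma] as an attained infimum *)

Lemma Gamma_ge_left F alpha a : a%:E <= Gamma alpha a F.
Proof. by apply: le_ereal_inf_tmp => b []. Qed.

Lemma Gamma_le F alpha a x :
  a%:E <= x -> alpha%:E <= F (itvR `[a%:E, x]) -> Gamma alpha a F <= x.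
Proof. by move=> ax aF; apply: ereal_inf_lbound. Qed.

Lemma itvR_lt_Gamma F alpha a x : a%:E <= x -> x < Gamma alpha a F ->
  F (itvR `[a%:E, x]) < alpha%:E.
Proof.
move=> ax xG; rewrite ltNge; apply/negP => aF.
by have := Gamma_le ax aF; rewrite leNgt xG.
Qed.

(* The cdf lemmas are stated for random variables; id has distribution F. *)
Definition idR : measurableTypeR R -> R := idfun.

HB.instance Definition _ :=
  @isMeasurableFun.Build _ _ _ _ idR (@measurable_id _ _ setT).

(* Right continuity of F makes the infimum defining Gamma attained. *)
Lemma Gamma_le_itvR F alpha a x : M_a0 alpha a F -> Gamma alpha a F <= x ->
  alpha%:E <= F (itvR `[a%:E, x]).
Proof.
move=> Fa.
have inf_lt y : Gamma alpha a F < y -> alpha%:E <= F (itvR `[a%:E, y]).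
  move=> /ereal_inf_lt[b [ab aFb] b_lt_y].
  by apply: (le_trans aFb); apply: itvR_le_measure; rewrite subitvE lexx /= ltW.
rewrite le_eqVlt => /predU1P[<-|]; last exact: inf_lt.
have := Gamma_ge_left F alpha a.
case: (Gamma alpha a F) inf_lt => [g||] inf_lt ag.
- have Fcvg : cdf (idR : {RV F >-> R}) t @[t --> g^'+] -->
      cdf (idR : {RV F >-> R}) g by exact: cdf_right_continuous.
  have Fcdf t : cdf (idR : {RV F >-> R}) t = F `]-oo, t]%classic by [].
  have Fg t : g%:E <= t%:E -> F `]-oo, t]%classic =
      F `]-oo, a[%classic + F (itvR `[a%:E, t%:E]).
    move=> gt; rewrite -(itvR_NyEFin false).
    by rewrite (itvR_split _ (a := a))// (le_trans ag).
  suff : F `]-oo, a[%classic + alpha%:E <= F `]-oo, g]%classic.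
    by rewrite Fg// leeD2lE// fin_num_measure.
  rewrite -Fcdf; apply: (cvge_to_ge Fcvg).
  near=> t.
  have gt : (g < t)%R by [].
  rewrite Fcdf Fg; last by rewrite lee_fin ltW.
  by rewrite leeD2l// inf_lt// lte_fin.
(* If [Gamma] is +oo, the mass available is 1 - F(a-), and [M_a0] says exactly that this is at least
   alpha. *)
- rewrite probability_itvRy leeBrDl; last by rewrite fin_num_measure.
  move: Fa; rewrite /M_a0 /= EFinB leeBrDr// addeC.
- by [].
Unshelve. all: by end_near. Qed.

(** * Strict identification for continuous, strictly increasing F *)

Lemma distr_funE F t : F `]-oo, t]%classic = (distr_fun F t)%:E.
Proof. by rewrite /distr_fun fineK// fin_num_measure. Qed.

Lemma itvR_lt_measure F a x y :
  M_inc_cont F -> a%:E <= x -> x < y -> F (itvR `[a%:E, x]) < F (itvR `[a%:E, y]).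
Proof.
move=> [_ Finc] ax xy.
have lt_EFin (r s : R) : a%:E <= r%:E -> (r < s)%R ->
    F (itvR `[a%:E, r%:E]) < F (itvR `[a%:E, s%:E]).
  move=> ar rs.
  have Fa : F `]-oo, a[%classic \is a fin_num by rewrite fin_num_measure.
  rewrite -(lteD2lE _ _ Fa) -!itvR_split//; last first.
    by rewrite (le_trans ar)// lee_fin ltW.
  by rewrite !(itvR_NyEFin false) !distr_funE lte_fin Finc.
case: x y ax xy => [r||] [s||] //= ar rs.
  by apply: lt_EFin => //; rewrite lte_fin in rs.
(* Strict monotonicity is available at real points only, so +oo is reached through r + 1. *)
have /lt_le_trans : F (itvR `[a%:E, r%:E]) < F (itvR `[a%:E, (r + 1)%:E]).
  by apply: lt_EFin => //; rewrite ltrDl.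
by apply; apply: itvR_le_measure; rewrite subitvE lexx /= bnd_simp leey.
Qed.

(** The point [x] belongs to the set defining [Gamma], so only Gamma < x has to be excluded: strict
    monotonicity would then put F([a, Gamma]) below alpha, although the infimum is attained. *)
Lemma itvR_eq_Gamma F alpha a x : M_a0 alpha a F -> M_inc_cont F -> a%:E <= x ->
  F (itvR `[a%:E, x]) = alpha%:E -> x = Gamma alpha a F.
Proof.
move=> Fa Finc ax Fx; apply/eqP; rewrite eq_le Gamma_le ?Fx// andbT leNgt.
apply/negP => /(itvR_lt_measure Finc (Gamma_ge_left _ _ _)).
by rewrite Fx ltNge Gamma_le_itvR.
Qed.

Lemma exists_itvR_eq F alpha a : M_a0 alpha a F -> M_inc_cont F ->
  (0 < alpha)%R -> exists2 x, a%:E <= x & F (itvR `[a%:E, x]) = alpha%:E.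
Proof.
move=> Fa [Fcont Finc] alpha0.
have Fafin : F `]-oo, a[%classic \is a fin_num by rewrite fin_num_measure.
set p := fine (F `]-oo, a[%classic).
have pE : F `]-oo, a[%classic = p%:E by rewrite fineK.
move: (Fa); rewrite /M_a0 /= pE lee_fin lerBrDr le_eqVlt => /predU1P[p1|p1].
  (* Case F(a-) = 1 - alpha: the whole mass of [a, oo[ is exactly alpha. *)
  exists +oo; first exact: leey.
  by rewrite probability_itvRy pE -EFinB -p1 addrAC subrr add0r.
(* Continuity excludes an atom at a: the bound F(t) <= F(a-) for t < a passes to the left limit. *)
have Fa_p : (distr_fun F a <= p)%R.
  apply: (cvgr_to_le (cvg_at_left_filter (Fcont a))).
  near=> t; rewrite -lee_fin -distr_funE -pE.
  apply: le_measure; rewrite ?inE//; apply: subset_itvl.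
  by rewrite bnd_simp.
have [b [ab pb]] : exists b, (a <= b)%R /\ (p + alpha <= distr_fun F b)%R.
  have Fcvg : cdf (idR : {RV F >-> R}) t @[t --> +oo%R] --> 1 by exact: cvg_cdfy1.
  have p1E : (p + alpha)%:E < 1 by rewrite lte_fin.
  have [M [_ M_lt]] := Fcvg _ (open_ereal_gt' p1E).
  (* M + 1 lies strictly beyond the threshold M, and the maximum with a gives the ordering required
     by the intermediate value theorem. *)
  exists (Num.max a (M + 1))%R; rewrite le_max lexx; split=> //.
  rewrite -lee_fin -distr_funE; apply/ltW/M_lt.
  by rewrite lt_max ltrDl ltr01 orbT.
have [||c] := IVT (f := distr_fun F) (v := (p + alpha)%R) ab.
- exact: continuous_subspaceT.
- rewrite ge_min le_max pb orbT (le_trans Fa_p)//= lerDl ltW//.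
rewrite in_itv /= => /andP[ac _] Fc.
exists c%:E; first by rewrite lee_fin.
have : F `]-oo, c]%classic = (p + alpha)%:E by rewrite distr_funE Fc.
rewrite -(itvR_NyEFin false) (itvR_split _ (a := a)) ?lee_fin// EFinD -pE => Fac.
by apply/le_anti/andP; split; rewrite -(leeD2lE _ _ Fafin) Fac lexx.
Unshelve. all: by end_near. Qed.

Lemma strict_identification_Vfun alpha a : (0 < alpha)%R ->
  strict_identification_function (M_a0 alpha a `&` @M_inc_cont R) (actions a)
    (Gamma alpha a) (Vfun alpha a).
Proof.
move=> alpha0; split=> [x F _ _|x F]; first exact: integrable_Vfun.
rewrite /actions /= in_itv /= leey andbT => ax [Fa Finc].
rewrite expectation_Vfun; split=> [Fx|->].
  apply: itvR_eq_Gamma => //.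
  by rewrite -[LHS](@subeK _ _ alpha%:E)// Fx add0e.
(* The point where the level alpha is taken must be [Gamma], hence F([a, Gamma]) = alpha. *)
have [y ay Fy] := exists_itvR_eq Fa Finc alpha0.
by rewrite -(itvR_eq_Gamma Fa Finc ay Fy) Fy subee.
Qed.

(** For real z the condition a <= y <= z separates into y >= a and z >= y, so in the variable z only
    the indicator of a half-line is left. This yields measurability in z and the closed form of
    S. *)
Lemma Vfun_EFin alpha a (z y : R) : (Vfun alpha a z%:E y =
  \1_(`[a, +oo[%classic) y * \1_(`[y, +oo[%classic) z - alpha)%R.
Proof.
rewrite /Vfun !indicE -natrM mulnb; congr ((nat_of_bool _)%:R - _)%R.
by apply/idP/idP; rewrite ?inE /itvR /= !mem_setE !in_itv /= !lee_fin !andbT.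
Qed.

(** * The scoring function and its expectation by Fubini *)

Context (mu : {finite_measure set (measurableTypeR R) -> \bar R}).

(** The expected identification function at real points; its sign governs the comparison of expected
    scores. *)
Definition excess F alpha a (z : R) : R :=
  (fine (F (itvR `[a%:E, z%:E])) - alpha)%R.

Lemma excessE F alpha a (z : R) :
  (excess F alpha a z)%:E = expectation_fun (Vfun alpha a) z%:E F.
Proof.
rewrite expectation_Vfun /excess EFinB fineK// fin_num_measure//.
exact: measurable_itvR.
Qed.

Lemma measurable_excess F alpha a (D : set R) : measurable D ->
  measurable_fun (D : set (measurableTypeR R)) (excess F alpha a).
Proof.
move=> mD; apply: nondecreasing_measurable => // z1 z2 z12.
rewrite /excess lerD2r fine_le ?fin_num_measure//; try exact: measurable_itvR.
by apply: itvR_le_measure; rewrite subitvE lexx /= bnd_simp lee_fin.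
Qed.

Lemma integrable_excess F alpha a (D : set R) : measurable D ->
  mu.-integrable D (EFin \o excess F alpha a).
Proof.
move=> mD.
apply: (@finite_measure_bounded_integrable _ _ _ mu D _ (1 + `|alpha|)%R) => //.
  exact: measurable_excess.
move=> z _; rewrite (le_trans (ler_normB _ _))// lerD2r ger0_norm ?fine_ge0//.
rewrite -lee_fin fineK ?probability_le1 ?fin_num_measure//; exact: measurable_itvR.
Qed.

(** The domain z >= x becomes a factor of the integrand, so that Fubini applies on the whole plane;
    [p.1] is the variable z of [mu] and [p.2] the observation y. *)
Definition truncated_V alpha a x (p : R * R) : R :=
  (\1_(itvR `[x, +oo[) p.1 * Vfun alpha a p.1%:E p.2)%R.

Lemma measurable_truncated_V alpha a x :
  measurable_fun [set: measurableTypeR R * measurableTypeR R]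
    (truncated_V alpha a x).
Proof.
(* Jointly in (z, y), V involves the indicator of the planar region a <= y <= z, which is cut out by
   comparisons of measurable functions. *)
have -> : truncated_V alpha a x = (fun p => (\1_(itvR `[x, +oo[ `*` [set: R]) p *
    (\1_([set p : R * R | a <= p.2] `&` [set p | p.2 <= p.1]) p - alpha))%R).
  apply/funext => -[z y]; rewrite /truncated_V /Vfun /= !indicE.
  congr ((nat_of_bool _)%:R * ((nat_of_bool _)%:R - _))%R.
    by apply/idP/idP; rewrite !inE => // -[].
  apply/idP/idP; rewrite !inE /itvR /= in_itv /= !lee_fin; first by move=> /andP.
  by move=> [-> ->].
have m12 (f g : R * R -> R) : measurable_fun setT f -> measurable_fun setT g ->
    measurable [set p | (f p <= g p)%R].
  move=> mf mg; have mtrue : measurable [set true] by [].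
  by have := measurable_fun_ler mf mg measurableT mtrue; rewrite setTI.
apply: measurable_funM.
  apply: measurable_indic; apply: measurableX => //; exact: measurable_itvR.
apply: measurable_funB => //; apply: measurable_indic; apply: measurableI.
  exact: m12.
exact: m12.
Qed.

Lemma truncated_V_bounded alpha a x p :
  (`|truncated_V alpha a x p| <= 1 + `|alpha|)%R.
Proof.
rewrite /truncated_V normrM -[leRHS]mul1r ler_pM//; last exact: Vfun_bounded.
by rewrite indicE; case: (_ \in _); rewrite ?normr0 ?normr1.
Qed.

Lemma integral_truncated_V alpha a x y :
  \int[mu]_(z in itvR `[x, +oo[) (Vfun alpha a z%:E y)%:E =
  \int[mu]_z (truncated_V alpha a x (z, y))%:E.
Proof.
rewrite integral_mkcond; apply: eq_integral => z _.
rewrite /patch /truncated_V /= indicE.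
by case: (_ \in _); rewrite ?mul1r ?mul0r.
Qed.

Lemma integrable_Vfun_mu alpha a y (D : set (measurableTypeR R)) : measurable D ->
  mu.-integrable D (fun z => (Vfun alpha a z%:E y)%:E).
Proof.
move=> mD.
apply: (@finite_measure_bounded_integrable _ _ _ mu D
          (fun z => Vfun alpha a z%:E y) (1 + `|alpha|)%R) => //; last first.
  by move=> z _; exact: Vfun_bounded.
under eq_fun do rewrite Vfun_EFin.
by apply: measurable_funTS; apply: measurable_funB => //; apply: measurable_funM.
Qed.

Lemma SfunE alpha a x y : (Sfun alpha a mu x y)%:E =
  - \int[mu]_z (truncated_V alpha a x (z, y))%:E.
Proof.
rewrite /Sfun /Rintegral EFinN fineK ?integral_truncated_V//.
rewrite -integral_truncated_V.
apply: integrable_fin_num; first exact: measurable_itvR.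
apply: integrable_Vfun_mu; exact: measurable_itvR.
Qed.

Lemma SfunE_measure alpha a x y : Sfun alpha a mu x y =
  (alpha * fine (mu (itvR `[x, +oo[))
   - fine (mu (itvR `[x, +oo[ `&` `[y, +oo[%classic)) * \1_(`[a, +oo[%classic) y)%R.
Proof.
have mA : measurable (itvR `[x, +oo[ : set (measurableTypeR R)).
  exact: measurable_itvR.
rewrite /Sfun; under eq_Rintegral do rewrite Vfun_EFin.
have i1 : mu.-integrable (itvR `[x, +oo[) (EFin \o \1_(`[y, +oo[%classic)).
  by apply: (integrableS measurableT) => //; exact: integrable_indic.
rewrite RintegralB//.
- rewrite RintegralZl// Rintegral_cst// opprB mulrC.
  congr (_ - _)%R; rewrite mulrC; congr (_ * _)%R.
  by rewrite /Rintegral integral_indic// setIC.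
- have := integrableZl mA (\1_(`[a, +oo[%classic) y) i1.
  by apply: eq_integrable => // z _; rewrite /= EFinM.
- exact: finite_measure_integrable_cst.
Qed.

(** The coordinates are swapped to put the observation first: the inner integral of Fubini then runs
    over z and equals -S(x, y). *)
Lemma integrable_truncated_V F alpha a x : (F \x mu)%E.-integrable setT
  (EFin \o (truncated_V alpha a x \o (fun q => (q.2, q.1)))).
Proof.
apply: (@product_measure_bounded_integrable _ _ _ _ _ F mu _ (1 + `|alpha|)%R).
  apply: measurableT_comp; first exact: measurable_truncated_V.
  exact: measurable_fun_pair.
by move=> t; exact: truncated_V_bounded.
Qed.

Lemma integrable_Sfun F alpha a x :
  F.-integrable [set: R] (EFin \o Sfun alpha a mu x).
Proof.
have := integrableN (integrable_fubini_F (integrable_truncated_V F alpha a x)).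
apply: eq_integrable => // y _.
by rewrite /= SfunE.
Qed.

(* By Fubini, since S(x, y) integrates -V(z, y) over z >= x. *)
Lemma expectation_Sfun F alpha a x :
  expectation_fun (Sfun alpha a mu) x F =
  - \int[mu]_(z in itvR `[x, +oo[) (excess F alpha a z)%:E.
Proof.
rewrite /expectation_fun; under eq_integral do rewrite SfunE.
rewrite integralN; last first.
  exact: (integrable_add_def _ (integrable_fubini_F (integrable_truncated_V F alpha a x))).
congr (- _); rewrite [RHS]integral_mkcond.
rewrite (Fubini (integrable_truncated_V F alpha a x)).
apply: eq_integral => z _ /=; rewrite /patch /truncated_V /= indicE.
case: (_ \in _).
  by rewrite excessE; apply: eq_integral => y _; rewrite mul1r.
by apply: integral0_eq => y _; rewrite mul0r.
Qed.

(** * Comparison of expected scores *)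

Lemma positive_measure_itvR a x y : positive_measure mu -> a%:E <= x -> x < y ->
  0 < mu (itvR `]x, y[).
Proof.
move=> mu0; case: x => [r||] //= ar ry; last by rewrite ltNge leey in ry.
(* As [y] may be +oo, a real [s] is chosen below it; the midpoint of [r] and [s] shows that the
   smaller interval is nonempty. *)
have [s rs sy] : exists2 s : R, (r < s)%R & s%:E <= y.
  case: y ry => [s||] //= rs; first by exists s => //; rewrite lte_fin in rs.
  by exists (r + 1)%R; rewrite ?leey// ltrDl.
apply: (@lt_le_trans _ _ (mu `]r, s[%classic)).
  apply: mu0; first exact: interval_open.
  by exists ((r + s) / 2)%R; rewrite /= in_itv /= midf_lt// midf_lt.
apply: le_measure; rewrite ?inE//; first exact: measurable_itvR.
move=> z; rewrite /itvR /= !in_itv /= => /andP[rz zs].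
by rewrite lte_fin rz /= (lt_le_trans _ sy)// lte_fin.
Qed.

Lemma itvR_cat x y : x <= y -> itvR `[x, +oo[ = itvR `[x, y[ `|` itvR `[y, +oo[.
Proof.
move=> xy; apply/seteqP; split => z; rewrite /itvR /setU /= !in_itv /= ?andbT.
  by move=> xz; rewrite xz /=; have [|] := ltP z%:E y; [left|right].
by case=> [/andP[]//|]; exact: le_trans.
Qed.

(** The tails from x and from y differ by [x, y[, and finiteness of the integrals allows
    rearranging. Comparing two actions thus reduces to the sign of the excess between them. *)
Lemma expectation_Sfun_split F alpha a x y : x <= y ->
  expectation_fun (Sfun alpha a mu) x F +
    \int[mu]_(z in itvR `[x, y[) (excess F alpha a z)%:E =
  expectation_fun (Sfun alpha a mu) y F.
Proof.
move=> xy; rewrite !expectation_Sfun (itvR_cat xy) integral_setU//=.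
- have fin i : \int[mu]_(z in itvR i) (excess F alpha a z)%:E \is a fin_num.
    apply: integrable_fin_num; first exact: measurable_itvR.
    by apply: integrable_excess; exact: measurable_itvR.
  by rewrite fin_num_oppeD// addeAC [X in X + _]addeC subee// add0e.
- exact: measurable_itvR.
- exact: measurable_itvR.
- rewrite -itvR_cat//; apply/measurable_EFinP; apply: measurable_excess.
  exact: measurable_itvR.
- apply/disj_set2P; rewrite -subset0 => z; rewrite /itvR /setI /= !in_itv /=.
  by rewrite andbT => -[/andP[_ zy]]; rewrite leNgt zy.
Qed.

Lemma expectation_Sfun_fin F alpha a x :
  expectation_fun (Sfun alpha a mu) x F \is a fin_num.
Proof. by apply: integrable_fin_num => //; exact: integrable_Sfun. Qed.

Lemma excess_lt0 F alpha a z : a%:E <= z%:E -> z%:E < Gamma alpha a F ->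
  (excess F alpha a z < 0)%R.
Proof.
move=> az zG; rewrite -lte_fin excessE expectation_Vfun.
by rewrite -[X in _ < X](subee (x := alpha%:E))// lteD2rE// itvR_lt_Gamma.
Qed.

Lemma excess_ge0 F alpha a z : M_a0 alpha a F -> Gamma alpha a F <= z%:E ->
  (0 <= excess F alpha a z)%R.
Proof.
move=> Fa Gz; rewrite -lee_fin excessE expectation_Vfun.
by rewrite sube_ge0// Gamma_le_itvR.
Qed.

(** If the excess vanished at some z > Gamma, then F([a, w]) would be squeezed to alpha for every w
    in ]Gamma, z], and all these w would be quantiles at level alpha + F(a-), against uniqueness. *)
Lemma excess_gt0 F alpha a z : M_a_alpha_inc alpha a F ->
  Gamma alpha a F < z%:E -> (0 < excess F alpha a z)%R.
Proof.
move=> [Fa [t qt]] Gz.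
rewrite lt_neqAle (excess_ge0 Fa (ltW Gz)) andbT; apply/negP => /eqP ez.
have Fafin : F `]-oo, a[%classic \is a fin_num by rewrite fin_num_measure.
have q w : Gamma alpha a F < w -> w <= z%:E ->
    quantile_set (alpha%:E + F `]-oo, a[%classic) F w.
  move=> Gw wz; have aw := le_trans (Gamma_ge_left F alpha a) (ltW Gw).
  have Fz : F (itvR `[a%:E, z%:E]) = alpha%:E.
    have := excessE F alpha a z; rewrite -ez expectation_Vfun => Fz.
    by rewrite -[LHS](@subeK _ _ alpha%:E)// -Fz add0e.
  have Fw : F (itvR `]-oo, w]) = alpha%:E + F `]-oo, a[%classic.
    rewrite (itvR_split _ aw) addeC; congr (_ + _).
    apply/le_anti/andP; split; last exact: Gamma_le_itvR Fa (ltW Gw).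
    by rewrite -Fz; apply: itvR_le_measure; rewrite subitvE lexx /= bnd_simp.
  rewrite /quantile_set /= Fw lexx andbT -Fw.
  by apply: itvR_le_measure; rewrite subitvE /= bnd_simp.
(* A second quantile besides z: [Gamma] is real, lying between a and z, so a midpoint exists. *)
have [w Gw wz] : exists2 w, Gamma alpha a F < w & w < z%:E.
  have := Gamma_ge_left F alpha a; case: (Gamma alpha a F) Gz => [g||]//= gz _.
  rewrite lte_fin in gz.
  by exists ((g + z) / 2)%:E; rewrite lte_fin midf_lt.
have := q _ Gz (lexx _); have := q _ Gw (ltW wz); rewrite qt /= => wt zt.
by move: wz; rewrite wt zt ltxx.
Qed.

Lemma consistent_Sfun alpha a :
  consistent (M_a0 alpha a) (actions a) (Gamma alpha a) (Sfun alpha a mu).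
Proof.
move=> x F; rewrite /actions /= in_itv /= leey andbT => ax Fa.
have [xG|/ltW Gx] := leP x (Gamma alpha a F).
(* The excess is negative on [x, Gamma[, so moving x up to [Gamma] cannot raise the expected
   score. *)
- rewrite -(expectation_Sfun_split F alpha a xG) geeDl ?expectation_Sfun_fin//.
  have mA : measurable (itvR `[x, Gamma alpha a F[ : set (measurableTypeR R)).
    exact: measurable_itvR.
  rewrite -[leRHS](integral0 mu (itvR `[x, Gamma alpha a F[)).
  apply: le_integral => //; [exact: integrable_excess|exact: integrable0|].
  move=> z; rewrite inE /itvR /= in_itv /= => /andP[xz zG].
  by rewrite lee_fin ltW// excess_lt0// (le_trans ax).
(* The excess is nonnegative on [Gamma, x[, so moving from [Gamma] up to x cannot lower the expected
   score. *)
- rewrite -(expectation_Sfun_split F alpha a Gx) leeDl//.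
  apply: integral_ge0 => z; rewrite /itvR /= in_itv /= => /andP[Gz zx].
  by rewrite lee_fin excess_ge0.
Qed.

Lemma strictly_consistent_Sfun alpha a : positive_measure mu ->
  strictly_consistent (M_a_alpha_inc alpha a) (actions a) (Gamma alpha a)
    (Sfun alpha a mu).
Proof.
move=> mu0; split=> [x F ax [Fa _]|x F]; first exact: consistent_Sfun.
rewrite /actions /= in_itv /= leey andbT => ax Finc eS.
have Fa : M_a0 alpha a F by case: Finc.
have aG := Gamma_ge_left F alpha a.
have mA i : measurable (itvR i : set (measurableTypeR R)).
  exact: measurable_itvR.
(* The integrals run over [y, z[, but the strict sign is used on the open interval: the excess may
   vanish at [Gamma]. *)
have oo_co (y z : \bar R) : itvR `]y, z[ `<=` itvR `[y, z[.
  by move=> w; rewrite /itvR /= !in_itv /= => /andP[/ltW -> ->].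
(* The finite expectations cancel in the splitting formula. *)
have eq0 y z : y <= z ->
    expectation_fun (Sfun alpha a mu) y F = expectation_fun (Sfun alpha a mu) z F ->
    \int[mu]_(w in itvR `[y, z[) (excess F alpha a w)%:E = 0.
  move=> /(expectation_Sfun_split F alpha a) <- /esym/eqP.
  rewrite -[X in _ == X]adde0.
  by move=> /eqP e; apply/le_anti/andP; split;
    rewrite -(leeD2lE _ _ (expectation_Sfun_fin F alpha a y)) e lexx.
have [xG|Gx|//] := ltgtP x (Gamma alpha a F).
(* Below [Gamma] the negated excess is positive, so equal scores would make [mu] vanish on a
   nonempty open interval. *)
- have := positive_measure_itvR mu0 ax xG.
  suff -> : mu (itvR `]x, Gamma alpha a F[) = 0 by rewrite ltxx.
  apply: (@ge0_integral_eq0 _ _ _ mu (itvR `[x, Gamma alpha a F[) _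
    (fun w => - excess F alpha a w)%R (mA _) (mA _) (oo_co _ _)).
  + exact: (measurable_funN (measurable_excess _ _ _ (mA _))).
  + move=> w; rewrite /itvR /= in_itv /= => /andP[xw wG].
    by rewrite oppr_ge0; apply/ltW/excess_lt0; [exact: le_trans ax xw|exact: wG].
  + move=> w; rewrite /itvR /= in_itv /= => /andP[xw wG].
    rewrite oppr_gt0; apply: excess_lt0; last exact: wG.
    exact: le_trans ax (ltW xw).
  + under eq_integral do rewrite EFinN.
    rewrite integralN; last first.
      exact: (integrable_add_def (mA _) (integrable_excess F alpha a (mA _))).
    by rewrite (eq0 _ _ (ltW xG) (esym eS)) oppe0.
(* Beyond [Gamma] the strict sign comes from uniqueness of the quantile. *)
- have := positive_measure_itvR mu0 aG Gx.
  suff -> : mu (itvR `]Gamma alpha a F, x[) = 0 by rewrite ltxx.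
  apply: (@ge0_integral_eq0 _ _ _ mu (itvR `[Gamma alpha a F, x[) _
    (excess F alpha a) (mA _) (mA _) (oo_co _ _)).
  + exact: (measurable_excess _ _ _ (mA _)).
  + move=> w; rewrite /itvR /= in_itv /= => /andP[Gw _]; exact: excess_ge0.
  + move=> w; rewrite /itvR /= in_itv /= => /andP[Gw _]; exact: excess_gt0.
  + exact: (eq0 _ _ (ltW Gx) eS).
Qed.

End systemic_quantile_theory.

(** The density is positive everywhere, so an open set that is null for the normal law would be
    Lebesgue null, yet it contains a ball of positive radius. *)
Lemma positive_normal_prob (R : realType) :
  positive_measure (normal_prob (0 : R) 1).
Proof.
move=> U oU [x Ux].
have mU : measurable (U : set (measurableTypeR R)) by exact: open_measurable.
have pdf_gt0 (t : R) : 0 < normal_pdf (0 : R) 1 t.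
  rewrite normal_pdfE ?oner_eq0//.
  by rewrite mulr_gt0 ?normal_peak_gt0 ?oner_eq0// expR_gt0.
rewrite lt_neqAle measure_ge0 andbT eq_sym; apply/negP => /eqP U0.
have : lebesgue_measure U = 0%E.
  apply: (@ge0_integral_eq0 _ _ _ lebesgue_measure U U (normal_pdf (0 : R) 1)
    mU mU) => //.
  - exact: measurable_funTS (measurable_normal_pdf _ _).
  - by move=> t _; exact: normal_pdf_ge0.
have [r r0 rU] : exists2 r : R, 0 < r & ball x r `<=` U.
  by move: oU; rewrite openE => /(_ x Ux) /nbhs_ballP[r r0 rU]; exists r.
have : (0 < lebesgue_measure (ball x r))%E.
  by rewrite lebesgue_measure_ball ?ltW// lte_fin pmulrn_lgt0.
move=> /[swap] U00; rewrite ltNge -U00 => /negP; apply.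
apply: le_measure; rewrite ?inE//.
exact: measurable_ball.
Qed.

Theorem propositionA1 (R : realType) (alpha a : R) (alpha01 : 0 < alpha < 1) :
  (* the functional takes its values in [a, +oo] *)
  set_fun (M_a0 alpha a) (actions a) (Gamma alpha a) /\
  (* (i) *)
  (identifiable (M_a0 alpha a `&` M_inc_cont) (actions a) (Gamma alpha a) /\
   strict_identification_function (M_a0 alpha a `&` M_inc_cont) (actions a)
     (Gamma alpha a) (Vfun alpha a)) /\
  (* (ii) *)
  (elicitable (M_a_alpha_inc alpha a) (actions a) (Gamma alpha a) /\
   forall mu : {finite_measure set (measurableTypeR R) -> \bar R},
     (forall (x : \bar R) (y : R), actions a x ->
        Sfun alpha a mu x y =
          alpha * fine (mu (itvR `[x, +oo[))
          - fine (mu (itvR `[x, +oo[ `&` `[y, +oo[%classic)) * \1_(`[a, +oo[%classic) y) /\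
     finite_expectations (M_a0 alpha a) (actions a) (Sfun alpha a mu) /\
     consistent (M_a0 alpha a) (actions a) (Gamma alpha a) (Sfun alpha a mu) /\
     (positive_measure mu ->
      strictly_consistent (M_a_alpha_inc alpha a) (actions a) (Gamma alpha a)
        (Sfun alpha a mu))).
Proof.
have /andP[alpha0 _] := alpha01.
have elicit (mu : {finite_measure set (measurableTypeR R) -> \bar R}) :
    positive_measure mu ->
    elicitable (M_a_alpha_inc alpha a) (actions a) (Gamma alpha a).
  move=> mu0; exists (Sfun alpha a mu); split.
    by move=> x F _ _; exact: integrable_Sfun.
  exact: strictly_consistent_Sfun.
split; [|split; split].
- by move=> F _; rewrite /actions /= in_itv /= leey andbT; exact: Gamma_ge_left.
- exists (Vfun alpha a); exact: strict_identification_Vfun.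
- exact: strict_identification_Vfun.
- exact: (elicit (normal_prob (0 : R) 1) (@positive_normal_prob R)).
- move=> mu; split; [|split; [|split]].
  + by move=> x y _; exact: SfunE_measure.
  + by move=> x F _ _; exact: integrable_Sfun.
  + exact: consistent_Sfun.
  + exact: strictly_consistent_Sfun.
Qed.
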